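(* Let $\mathcal{C}_1=(\mathrm{A}_1,\Gamma_1)$ and $\mathcal{C}_2=(\mathrm{A}_2,\Gamma_2)$ be contracts. Suppose that at least one of the following conditions holds: 1. $\mathfrak{B}_{\mathrm i}(\mathrm{A}_1)=\mathfrak{B}_{\mathrm i}(\mathrm{A}_2)$; 2. $\mathfrak{B}((\mathrm{A}_1\vee\mathrm{A}_2)\wedge\Gamma_1)=\mathfrak{B}((\mathrm{A}_1\vee\mathrm{A}_2)\wedge\Gamma_2)$. Then the conjunction of $\mathcal{C}_1$ and $\mathcal{C}_2$ exists and is given by $$\mathcal{C}_1\wedge\mathcal{C}_2=(\mathrm{A}_1\vee\mathrm{A}_2,\ \Gamma_1\wedge\Gamma_2).$$
   Context: Fix numbers $m$ of inputs and $p$ of outputs, common to all systems and contracts. $\mathcal{C}^\infty_n$ denotes the space of smooth functions $\mathbb{R}\to\mathbb{R}^n$. All polynomials are univariate with real coefficients; polynomial (rational) matrices are matrices with polynomial (rational function) entries. A rational function is proper if the degree of its denominator is at least the degree of its numerator; a rational matrix is proper if all its entries are. A square polynomial matrix $P(s)$ is invertible if it has an inverse that is a rational matrix. The symbol $\subset$ denotes (not necessarily strict) inclusion. Systems. A system $\Sigma: P\left(\tfrac{d}{dt}\right) y = Q\left(\tfrac{d}{dt}\right) u$, with $u\in\mathcal{C}^\infty_m$, $y\in\mathcal{C}^\infty_p$ and $P(s),Q(s)$ polynomial matrices, is in input-output form if $P(s)$ is (square and) invertible and $P(s)^{-1}Q(s)$ is proper. Its external behaviour is $\mathfrak{B}(\Sigma)=\{(u,y)\in\mathcal{C}^\infty_{m+p}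 : P(\tfrac{d}{dt})y=Q(\tfrac{d}{dt})u\}$. Environments and assumptions. An environment $\mathrm{E}$ is a system $0=E\left(\tfrac{d}{dt}\right)u$ with $u\in\mathcal{C}^\infty_m$ and $E(s)$ a polynomial matrix; its input behaviour is $\mathfrak{B}_{\mathrm i}(\mathrm{E})=\{u\in\mathcal{C}^\infty_m : E(\tfrac{d}{dt})u=0\}$. Assumptions $\mathrm{A}$ are a system of the same form, $0=A\left(\tfrac{d}{dt}\right)u$ with $A(s)$ a polynomial matrix, with input behaviour $\mathfrak{B}_{\mathrm i}(\mathrm{A})$ defined in the same way. Guarantees. Guarantees $\Gamma$ are a system $G\left(\tfrac{d}{dt}\right)y=H\left(\tfrac{d}{dt}\right)u$ with $u\in\mathcal{C}^\infty_m$, $y\in\mathcal{C}^\infty_p$ and arbitrary polynomial matrices $G(s),H(s)$; its external behaviour is $\mathfrak{B}(\Gamma)=\{(u,y)\in\mathcal{C}^\infty_{m+p}: G(\tfrac{d}{dt})y=H(\tfrac{d}{dt})u\}$. Interconnection. For an environment (or assumptions) $\mathrm{E}$ and a system or guarantees $\mathrm{F}$ in the variables $(u,y)$, $\mathrm{E}\wedge \mathrm{F}$ is the system obtained by imposing both sets of equations, so $\mathfrak{B}(\mathrm{E}\wedge \mathrm{F})=\{(u,y)\in\mathfrak{B}(\mathrm{F}): u\in\mathfrak{B}_{\mathrm i}(\mathrm{E})\}$. Join of assumptions. For assumptions $\mathrm{A}_j: 0=A_j(\tfrac{d}{dt})u$, $j\in\{1,2\}$, the join $\mathrm{A}_1\vee\mathrm{A}_2$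 is the system with latent variables $l_1,l_2\in\mathcal{C}^\infty_m$ given by $l_1+l_2=u$, $A_1(\tfrac{d}{dt})l_1=0$, $A_2(\tfrac{d}{dt})l_2=0$. Its input behaviour $\mathfrak{B}_{\mathrm i}(\mathrm{A}_1\vee\mathrm{A}_2)$ is the set of $u\in\mathcal{C}^\infty_m$ for which such $l_1,l_2$ exist. By the elimination theorem of behavioural systems theory, the latent variables can be eliminated, so that this set is the input behaviour of assumptions of the form $0=A(\tfrac{d}{dt})u$ with $A(s)$ a polynomial matrix; $\mathrm{A}_1\vee\mathrm{A}_2$ is regarded as assumptions in this sense. Meet of guarantees. For guarantees $\Gamma_j: G_j(\tfrac{d}{dt})y=H_j(\tfrac{d}{dt})u$, $j\in\{1,2\}$, the meet $\Gamma_1\wedge\Gamma_2$ is the guarantees given by both equations $G_1(\tfrac{d}{dt})y=H_1(\tfrac{d}{dt})u$ and $G_2(\tfrac{d}{dt})y=H_2(\tfrac{d}{dt})u$ stacked. Contracts. A contract $\mathcal{C}=(\mathrm{A},\Gamma)$ is a pair of assumptions $\mathrm{A}$ and guarantees $\Gamma$. An environment $\mathrm{E}$ is compatible with $\mathcal{C}$ if $\mathfrak{B}_{\mathrm i}(\mathrm{E})\subset\mathfrak{B}_{\mathrm i}(\mathrm{A})$. A system $\Sigma$ in input-output form implements $\mathcal{C}$ (is an implementation of $\mathcal{C}$) if $\mathfrak{B}(\mathrm{E}\wedge\Sigma)\subset\mathfrak{B}(\Gamma)$ for all environments $\mathrm{E}$ compatible with $\mathcal{C}$. Refinement. The contract $\mathcal{C}_1$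 refines the contract $\mathcal{C}_2$ if (1) all environments compatible with $\mathcal{C}_2$ are compatible with $\mathcal{C}_1$, and (2) all implementations of $\mathcal{C}_1$ are implementations of $\mathcal{C}_2$. Conjunction. The conjunction $\mathcal{C}_1\wedge\mathcal{C}_2$ of contracts $\mathcal{C}_1$ and $\mathcal{C}_2$ is the largest (with respect to refinement) contract that refines both $\mathcal{C}_1$ and $\mathcal{C}_2$; that is, a contract that refines both $\mathcal{C}_1$ and $\mathcal{C}_2$ and is refined by any contract that refines both $\mathcal{C}_1$ and $\mathcal{C}_2$. Such a contract does not necessarily exist in general, and it is determined only up to mutual refinement. *)

(* Defs.v *)
From mathcomp Require Import all_boot all_order all_algebra.
From mathcomp Require Import fraction.
From mathcomp Require Import boolp classical_sets reals topology normedtype derive.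

Set Implicit Arguments.
Unset Strict Implicit.
Unset Printing Implicit Defensive.

Import Order.TTheory GRing.Theory Num.Theory.
Import numFieldNormedType.Exports.

Local Open Scope classical_set_scope.
Local Open Scope ring_scope.

(* Outside the smooth functions [derive1n k f] is a junk value, so every behaviour
   below is cut down to smooth trajectories. *)
Definition smooth (R : realType) (n : nat) (f : R -> 'cV[R]_n) : Prop :=
  forall (k : nat) (t : R), derivable (derive1n k f) t 1.

(* The function M(d/dt) w. *)
Definition diffop (R : realType) (k n : nat) (M : 'M[{poly R}]_(k, n))
    (w : R -> 'cV[R]_n) : R -> 'cV[R]_k :=
  fun t => \col_i \sum_(j < n) \sum_(d < size (M i j))
             (M i j)`_d * (derive1n d w t) j 0.

(* The system 0 = E(d/dt) u; the number of equations is arbitrary. Both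
   environments and assumptions are of this form. *)
Record input_system (R : realType) (m : nat) := InputSystem {
  input_rows : nat;
  input_mx : 'M[{poly R}]_(input_rows, m)
}.

(* The system G(d/dt) y = H(d/dt) u; the number of equations is arbitrary. *)
Record system (R : realType) (m p : nat) := System {
  rows : nat;
  out_mx : 'M[{poly R}]_(rows, p);
  in_mx : 'M[{poly R}]_(rows, m)
}.

Definition input_behaviour (R : realType) (m : nat) (E : input_system R m) :
    set (R -> 'cV[R]_m) :=
  [set u | smooth u /\ diffop (input_mx E) u = (fun=> 0)].

Definition behaviour (R : realType) (m p : nat) (S : system R m p) :
    set ((R -> 'cV[R]_m) * (R -> 'cV[R]_p)) :=
  [set w | [/\ smooth w.1, smooth w.2 &
               diffop (out_mx S) w.2 = diffop (in_mx S) w.1]].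

(* Properness does not depend on the representation of r as a quotient: all
   representations have the same difference of degrees. Since [size] is the
   degree plus one, and 0 for the zero polynomial, r = 0 is proper. *)
Definition proper_frac (R : realType) (r : {fraction {poly R}}) : Prop :=
  exists a b : {poly R},
    [/\ b != 0, r = tofrac a / tofrac b & (size a <= size b)%N].

Definition in_io_form (R : realType) (m p : nat)
    (P : 'M[{poly R}]_p) (Q : 'M[{poly R}]_(p, m)) : Prop :=
  map_mx (@tofrac _) P \in unitmx /\
  forall i j, proper_frac
    ((invmx (map_mx (@tofrac _) P) *m map_mx (@tofrac _) Q) i j).

Record io_system (R : realType) (m p : nat) := IOSystem {
  io_out_mx : 'M[{poly R}]_p;
  io_in_mx : 'M[{poly R}]_(p, m);
  io_formP : in_io_form io_out_mx io_in_mx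
}.

Coercion system_of_io (R : realType) (m p : nat) (S : io_system R m p) :
  system R m p := System (io_out_mx S) (io_in_mx S).

(* The behaviour of E /\ F, where U is the input behaviour of E. Taking U
   instead of E makes this apply to a join of assumptions without choosing
   polynomial equations that represent it. *)
Definition interconnection (R : realType) (m p : nat)
    (U : set (R -> 'cV[R]_m)) (F : system R m p) :
    set ((R -> 'cV[R]_m) * (R -> 'cV[R]_p)) :=
  [set w | behaviour F w /\ U w.1].

Definition join_behaviour (R : realType) (m : nat)
    (A1 A2 : input_system R m) : set (R -> 'cV[R]_m) :=
  [set u | smooth u /\ exists l1 l2 : R -> 'cV[R]_m,
     [/\ smooth l1, smooth l2,
         (fun t => l1 t + l2 t) = u,
         diffop (input_mx A1) l1 = (fun=> 0) &
         diffop (input_mx A2) l2 = (fun=> 0)]].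

(* The assumptions A result from eliminating the latent variables l1, l2 from
   the join of A1 and A2. *)
Definition is_join (R : realType) (m : nat) (A1 A2 A : input_system R m) :
    Prop :=
  input_behaviour A = join_behaviour A1 A2.

Definition meet (R : realType) (m p : nat) (G1 G2 : system R m p) :
    system R m p :=
  System (col_mx (out_mx G1) (out_mx G2)) (col_mx (in_mx G1) (in_mx G2)).

Record contract (R : realType) (m p : nat) := Contract {
  assumptions : input_system R m;
  guarantees : system R m p
}.

Definition compatible (R : realType) (m p : nat) (E : input_system R m)
    (C : contract R m p) : Prop :=
  input_behaviour E `<=` input_behaviour (assumptions C).

Definition implements (R : realType) (m p : nat) (S : io_system R m p)
    (C : contract R m p) : Prop :=
  forall E : input_system R m, compatible E C ->
    interconnection (input_behaviour E) S `<=` behaviour (guarantees C).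

Definition refines (R : realType) (m p : nat) (C1 C2 : contract R m p) : Prop :=
  (forall E : input_system R m, compatible E C2 -> compatible E C1) /\
  (forall S : io_system R m p, implements S C1 -> implements S C2).

(* A greatest lower bound for the refinement preorder; it is determined only up
   to mutual refinement, hence a predicate. *)
Definition is_conjunction (R : realType) (m p : nat)
    (C1 C2 C : contract R m p) : Prop :=
  [/\ refines C C1, refines C C2 &
      forall C' : contract R m p,
        refines C' C1 -> refines C' C2 -> refines C' C].

(* Main.v *)
Require Import Defs.
From mathcomp Require Import all_boot all_order all_algebra.
From mathcomp Require Import fraction.
From mathcomp Require Import boolp classical_sets reals topology normedtype derive.
From mathcomp Require Import functions ereal sequences measure lebesgue_measure.
From mathcomp Require Import lebesgue_integral realfun exp trigo ftc.
From mathcomp Require Import complex ring zify.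

(** A system S implements (A, G) exactly when every trajectory (u, y) of S with
    u in the input behaviour of A lies in the behaviour of G: the largest
    compatible environment is A itself. Call U1, U2 the input behaviours of A1,
    A2; they are linear spaces, so the behaviour of the join is the sum U1 + U2,
    the least linear space containing both. Hence (A1 \/ A2, G1 /\ G2) refines
    both contracts, and any contract that refines both of them accepts all the
    environments that it accepts.

    What remains is to show that a system S implementing both (A1, G1) and
    (A2, G2) implements (A1 \/ A2, G1 /\ G2). If U1 = U2 then U1 + U2 = U1 and
    there is nothing to do. Suppose then that G1 and G2 have the same
    trajectories with input in U1 + U2, and let (u, y) be in S with u = l1 + l2,
    l1 in U1, l2 in U2. Since S accepts every smooth input
    ([io_system_total]), there is y1 with (l1, y1) in S, and then by linearity
    (l2, y - y1) is in S as well. The first pair satisfies G1 and the second one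
    G2. Both l1 and l2 belong to U1 + U2, so both pairs satisfy both guarantees,
    and so does their sum (u, y).

    Two facts about differential equations are behind this argument.

    - If det P is not 0, then P(d/dt) is onto on smooth functions
      ([diffop_surj]). Multiplication by the adjugate of P reduces this to a
      nonzero scalar polynomial p ([scalar_op_surj]); real factors of p of
      degrees one and two are inverted one at a time, and for them variation of
      constants gives an explicit solution ([damped_rotation_ode]).

    - The sum U1 + U2 is the input behaviour of polynomial equations
      ([join_exists]). This is elimination of latent variables: the image of a
      polynomial differential operator is the kernel of another one
      ([image_has_kernel_representation]). Columns are eliminated one at a
      time. The Euclidean algorithm on rows leaves at most one nonzero entry,
      the pivot, in the column; the pivot's equation can always be solved, by
      the surjectivity of scalar operators, for the latent variable of that
      column, so it imposes nothing and may be dropped. *)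

Set Implicit Arguments.
Unset Strict Implicit.
Unset Printing Implicit Defensive.

Import Order.TTheory GRing.Theory Num.Theory.
Import numFieldNormedType.Exports.

Local Open Scope classical_set_scope.
Local Open Scope ring_scope.

(** * Antiderivatives and planar linear equations *)

(** The lower end of integration must be to the left of every point at which
    the integral is differentiated. A function that vanishes on the negative
    half-line can be integrated from minus infinity, which serves all points at
    once. *)
Lemma antiderivative_pos (R : realType) (h : R -> R) :
  continuous h -> (forall t : R, t <= 0 -> h t = 0) ->
  exists H : R -> R, forall t : R, is_derive t 1 H (h t).
Proof.
move=> ch h0.
have hi (u : R) : (@lebesgue_measure R).-integrable `]-oo, u] (EFin \o h).
  rewrite integrable_mkcond //=.
  have -> : (EFin \o h) \_ `]-oo, u] = (EFin \o h) \_ `[0, u].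
    apply/funext => t; rewrite !patchE /=.
    have [tu|tu] := leP t u; have [t0|t0] := leP 0 t.
    - by rewrite !mem_set //= in_itv /= ?t0 ?tu.
    - rewrite mem_set ?in_itv //= memNset; last by rewrite /= in_itv /= leNgt t0.
      by rewrite h0 // ltW.
    - by rewrite !memNset //= in_itv /= ?t0 /= leNgt tu.
    - by rewrite !memNset //= in_itv /= ?leNgt ?t0 /= ?leNgt ?tu.
  rewrite -integrable_mkcond //.
  apply: continuous_compact_integrable; first exact: segment_compact.
  exact: continuous_subspaceT.
exists (fun y => Rintegral lebesgue_measure `]-oo, y] h) => t.
have [] := @continuous_FTC1 R h -oo%O t (t + 1) _ (hi _) _ _ => //.
- by rewrite ltrDl.
- by rewrite ltNyr.
- exact: ch.
by move=> dF Ft; split => //; rewrite -derive1E.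
Qed.

(** h - h 0 is the sum of a function vanishing on the left of 0 and of one
    vanishing on the right; the latter is reflected to use
    [antiderivative_pos]. *)
Lemma antiderivative (R : realType) (h : R -> R) :
  continuous h -> exists H : R -> R, forall t : R, is_derive t 1 H (h t).
Proof.
move=> ch.
pose M (t : R) : R := Num.max t 0.
have ML (t : R) : 0 <= t -> M t = t by move=> t0; rewrite /M max_l.
have MR (t : R) : t <= 0 -> M t = 0 by move=> t0; rewrite /M max_r.
have cmax : continuous M.
  move=> t; apply: (@continuous_max _ _ (@idfun R) (cst 0)); [exact: cvg_id|exact: cvg_cst].
pose r (t : R) : R := h (M t) - h 0.
pose l (t : R) : R := h (- M t) - h 0.
have cr : continuous r.
  move=> t; apply: cvgB; last exact: cvg_cst.
  by apply: continuous_comp; [exact: cmax | exact: ch].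
have cl : continuous l.
  move=> t; apply: cvgB; last exact: cvg_cst.
  apply: continuous_comp; last exact: ch.
  by apply: cvgN; exact: cmax.
have [|P dP] := antiderivative_pos cr.
  by move=> t t0; rewrite /r MR // subrr.
have [|Q dQ] := antiderivative_pos cl.
  by move=> t t0; rewrite /l MR // oppr0 subrr.
exists (P - (Q \o -%R) + (h 0 \*: idfun)) => t.
have dQN : is_derive t 1 (Q \o -%R) (l (- t) * -1) by exact: is_derive1_comp.
apply: is_derive_eq.
rewrite /r /l /GRing.scale /=.
have [t0|/ltW t0] := leP 0 t.
  by rewrite (ML t) // MR ?oppr_le0 // oppr0; ring.
by rewrite (MR t) // ML ?opprK ?oppr_ge0 //; ring.
Qed.

(** In complex form, with z = x + iy and c = a + ib, the system reads
    z' = c z + i g. Variation of constants gives z = exp(ct) W with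
    W' = exp(-ct) i g; the real and imaginary parts of W are F and G below. For
    b = 0 the second equation is the general first-order equation, and for b
    nonzero x solves a second-order one, so this system covers both kinds of
    irreducible real polynomials. *)
Lemma damped_rotation_ode (R : realType) (a b : R) (g : R -> R) :
  continuous g ->
  exists x y : R -> R, forall t : R,
    is_derive t 1 x (a * x t - b * y t) /\
    is_derive t 1 y (b * x t + a * y t + g t).

Proof.
move=> cg.
pose e (c : R) t : R := expR (c * t).
pose s (c : R) t : R := sin (c * t).
pose k (c : R) t : R := cos (c * t).
have dlin (c t : R) : is_derive t 1 (fun t : R => c * t) c.
  have := @is_deriveZ R R R idfun c t 1 1 _.
  by rewrite /GRing.scale /= mulr1; apply.
have de c (t : R) : is_derive t 1 (e c) (e c t * c) by exact: (is_derive1_comp _ (dlin c t)).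
have ds c (t : R) : is_derive t 1 (s c) (k c t * c) by exact: (is_derive1_comp _ (dlin c t)).
have dk c (t : R) : is_derive t 1 (k c) (- s c t * c) by exact: (is_derive1_comp _ (dlin c t)).
have cont (f df : R -> R) : (forall t : R, is_derive t 1 f (df t)) -> continuous f.
  by move=> fd t; apply/differentiable_continuous/derivable1_diffP; case: (fd t).
have [|F dF] := @antiderivative R (fun t => e (- a) t * s b t * g t).
  by move=> t; apply: cvgM; [apply: cvgM|exact: cg]; [exact: cont (de _) t|exact: cont (ds _) t].
have [|G dG] := @antiderivative R (fun t => e (- a) t * k b t * g t).
  by move=> t; apply: cvgM; [apply: cvgM|exact: cg]; [exact: cont (de _) t|exact: cont (dk _) t].
exists (e a * (k b * F - s b * G)), (e a * (s b * F + k b * G)) => t.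
have ee : e a t * e (- a) t = 1 by rewrite /e mulNr -expRD subrr expR0.
have sk : s b t * s b t + k b t * k b t = 1 by rewrite -!expr2 /s /k addrC cos2Dsin2.
split; apply: is_derive_eq; rewrite /GRing.scale /= !fctE.
  by ring.
have gE : g t = (e a t * e (- a) t) * (s b t * s b t + k b t * k b t) * g t.
  by rewrite ee sk !mul1r.
by rewrite [X in _ = _ + X]gE; ring.
Qed.

(** * Scalar differential operators on smooth functions *)

Definition scalar_smooth (R : realType) (f : R -> R) : Prop :=
  forall (k : nat) (t : R), derivable (derive1n k f) t 1.

(** Differentiability to a finite order, with the first derivative split off:
    solutions of a differential equation are shown to be smooth by induction on
    the order, which [scalar_smooth] does not allow. *)
Fixpoint differentiable_upto (R : realType) (k : nat) (f : R -> R) : Prop :=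
  (forall t : R, derivable f t 1) /\
  if k is k'.+1 then differentiable_upto k' (derive1 f) else True.

Lemma scalar_smoothP (R : realType) (f : R -> R) :
  scalar_smooth f <-> forall k, differentiable_upto k f.
Proof.
split=> [sf k|df].
  elim: k f sf => [|k IHk] f sf /=; split => //; try exact: (sf 0%N).
  by apply: IHk => j t; move: (sf j.+1 t); rewrite /derive1n iterSr.
move=> k; elim: k f df => [|k IHk] f df t; first by have [] := df 0%N.
rewrite /derive1n iterSr; apply: IHk => j.
by have [] := df j.+1.
Qed.

Lemma derive1_linear (R : realType) (c : R) (f g : R -> R) :
  (forall t : R, derivable f t 1) -> (forall t : R, derivable g t 1) ->
  derive1 (c *: f + g) = c *: derive1 f + derive1 g.
Proof.
move=> df dg; apply/funext => t.
rewrite fctE derive1E deriveD //; last exact: derivableZ.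
by rewrite deriveZ // -!derive1E.
Qed.

Lemma differentiable_upto_linear (R : realType) k (c : R) (f g : R -> R) :
  differentiable_upto k f -> differentiable_upto k g ->
  differentiable_upto k (c *: f + g).
Proof.
elim: k f g => [|k IHk] f g /= [df f'] [dg g'].
  by split => // t; apply: derivableD => //; exact: derivableZ.
split; first by move=> t; apply: derivableD => //; exact: derivableZ.
by rewrite derive1_linear //; exact: IHk.
Qed.

Lemma scalar_smooth_linear (R : realType) (c : R) (f g : R -> R) :
  scalar_smooth f -> scalar_smooth g -> scalar_smooth (c *: f + g).
Proof.
move=> /scalar_smoothP sf /scalar_smoothP sg; apply/scalar_smoothP => k.
exact: differentiable_upto_linear.
Qed.

Lemma scalar_smooth0 (R : realType) : scalar_smooth (0 : R -> R).
Proof.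
apply/scalar_smoothP; elim=> [|k IHk]; split => //; try by move=> t; exact: derivable_cst.
suff -> : derive1 (0 : R -> R) = 0 by [].
by apply/funext => t; exact: (derive1_cst 0 t).
Qed.

Lemma scalar_smoothZ (R : realType) (c : R) (f : R -> R) :
  scalar_smooth f -> scalar_smooth (c *: f).
Proof.
by move=> sf; rewrite -[_ *: _]addr0; apply: scalar_smooth_linear => //; exact: scalar_smooth0.
Qed.

Lemma scalar_smoothD (R : realType) (f g : R -> R) :
  scalar_smooth f -> scalar_smooth g -> scalar_smooth (f + g).
Proof. by rewrite -{2}(scale1r f); exact: scalar_smooth_linear. Qed.

Lemma scalar_smooth_sum (R : realType) (I : Type) (r : seq I) (F : I -> R -> R) :
  (forall i, scalar_smooth (F i)) -> scalar_smooth (\sum_(i <- r) F i).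
Proof.
move=> sF; elim/big_ind: _ => // [|f g]; [exact: scalar_smooth0|exact: scalar_smoothD].
Qed.

Lemma scalar_smooth_derive1 (R : realType) (f : R -> R) :
  scalar_smooth f -> scalar_smooth (derive1 f).
Proof. by move=> sf k t; move: (sf k.+1 t); rewrite /derive1n iterSr. Qed.

Lemma scalar_smooth_derive1n (R : realType) (n : nat) (f : R -> R) :
  scalar_smooth f -> scalar_smooth (derive1n n f).
Proof. by move=> sf; elim: n => // n /scalar_smooth_derive1; rewrite derive1nS. Qed.

Lemma scalar_smooth_derivable (R : realType) (f : R -> R) (t : R) :
  scalar_smooth f -> derivable f t 1.
Proof. by move=> /(_ 0%N). Qed.

Lemma scalar_smooth_continuous (R : realType) (f : R -> R) :
  scalar_smooth f -> continuous f.
Proof.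
move=> sf t; apply/differentiable_continuous/derivable1_diffP.
exact: scalar_smooth_derivable.
Qed.

Definition scalar_op (R : realType) (p : {poly R}) (f : R -> R) : R -> R :=
  \sum_(d < size p) p`_d *: derive1n d f.

Section ScalarOp.
Context (R : realType).
Implicit Types (p q : {poly R}) (f g : R -> R).

(** [scalar_op] sums up to the degree of the polynomial; a common larger bound
    makes operators of different degrees comparable. *)
Lemma scalar_op_widen n p f : (size p <= n)%N ->
  scalar_op p f = \sum_(d < n) p`_d *: derive1n d f.
Proof.
move=> pn; rewrite /scalar_op (big_ord_widen n (fun d => p`_d *: derive1n d f)) //.
rewrite big_mkcond; apply: eq_bigr => i _; case: ltnP => // pi.
by rewrite nth_default // scale0r.
Qed.

Lemma scalar_opD p q f : scalar_op (p + q) f = scalar_op p f + scalar_op q f.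
Proof.
rewrite (scalar_op_widen f (size_polyD p q)).
rewrite (scalar_op_widen f (leq_maxl (size p) (size q))).
rewrite (scalar_op_widen f (leq_maxr (size p) (size q))) -big_split.
by apply: eq_bigr => i _; rewrite coefD scalerDl.
Qed.

Lemma scalar_opZ c p f : scalar_op (c *: p) f = c *: scalar_op p f.
Proof.
rewrite (scalar_op_widen f (size_scale_leq _ _)) scaler_sumr.
by apply: eq_bigr => i _; rewrite coefZ scalerA.
Qed.

Lemma scalar_opC c f : scalar_op c%:P f = c *: f.
Proof.
by rewrite (scalar_op_widen f (size_polyC_leq1 _)) big_ord1 coefC eqxx.
Qed.

Lemma scalar_op0 f : scalar_op 0 f = 0.
Proof. by rewrite /scalar_op size_poly0 big_ord0. Qed.

Lemma scalar_op_sum (I : Type) (r : seq I) (F : I -> {poly R}) f :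
  scalar_op (\sum_(i <- r) F i) f = \sum_(i <- r) scalar_op (F i) f.
Proof.
elim/big_rec2: _ => [|i y1 y2 _ <-]; [exact: scalar_op0|exact: scalar_opD].
Qed.

Lemma scalar_op1 f : scalar_op 1 f = f.
Proof. by rewrite -[1]/(1%:P) scalar_opC scale1r. Qed.

Lemma scalar_opMX p f : scalar_op (p * 'X) f = scalar_op p (derive1 f).
Proof.
have szX : (size (p * 'X)%R <= (size p).+1)%N.
  by rewrite (leq_trans (size_polyMleq _ _)) // size_polyX addn2.
rewrite (scalar_op_widen f szX) big_ord_recl coefMX eqxx scale0r add0r.
by apply: eq_bigr => i _; rewrite lift0 coefMX /derive1n iterSr.
Qed.

Lemma scalar_smooth_op p f : scalar_smooth f -> scalar_smooth (scalar_op p f).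
Proof.
move=> sf; apply: scalar_smooth_sum => i.
exact/scalar_smoothZ/scalar_smooth_derive1n.
Qed.

Lemma derive1_op p f : scalar_smooth f ->
  derive1 (scalar_op p f) = scalar_op p (derive1 f).
Proof.
elim/poly_ind: p f => [|p c IHp] f sf.
  by rewrite !scalar_op0; apply/funext => t; exact: (derive1_cst 0 t).
have sf' := scalar_smooth_derive1 sf.
rewrite !scalar_opD !scalar_opMX !scalar_opC [_ + c *: f]addrC.
rewrite derive1_linear; first by rewrite IHp // addrC.
  by move=> t; exact: scalar_smooth_derivable.
by move=> t; apply/scalar_smooth_derivable/scalar_smooth_op.
Qed.

(** Substitution of d/dt is multiplicative: this is the module structure of the
    smooth functions over the polynomials. Smoothness is needed for d/dt to be
    additive. *)
Lemma scalar_op_mul p q f : scalar_smooth f ->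
  scalar_op (p * q) f = scalar_op p (scalar_op q f).
Proof.
elim/poly_ind: p f => [|p c IHp] f sf; first by rewrite mul0r !scalar_op0.
have sf' := scalar_smooth_derive1 sf.
rewrite mulrDl -mulrA [_ * q]mulrC mulrA !scalar_opD !scalar_opMX IHp // derive1_op //.
by rewrite mul_polyC scalar_opZ scalar_opC.
Qed.

Lemma scalar_op_linear p c f g : scalar_smooth f -> scalar_smooth g ->
  scalar_op p (c *: f + g) = c *: scalar_op p f + scalar_op p g.
Proof.
elim/poly_ind: p f g => [|p d IHp] f g sf sg.
  by rewrite !scalar_op0 scaler0 addr0.
rewrite !scalar_opD !scalar_opMX !scalar_opC derive1_linear; last 2 first.
- by move=> t; exact: scalar_smooth_derivable.
- by move=> t; exact: scalar_smooth_derivable.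
rewrite IHp; [|exact: scalar_smooth_derive1..].
by rewrite !scalerDr !scalerA [d * c]mulrC addrACA.
Qed.

Lemma scalar_opDr p f g : scalar_smooth f -> scalar_smooth g ->
  scalar_op p (f + g) = scalar_op p f + scalar_op p g.
Proof. by move=> sf sg; rewrite -{1}(scale1r f) scalar_op_linear // scale1r. Qed.

Lemma scalar_op0r p : scalar_op p 0 = 0.
Proof.
rewrite -{1}[0](addr0 _) -{1}(scaler0 _ (-1)) scalar_op_linear; try exact: scalar_smooth0.
by rewrite scaleN1r addNr.
Qed.

Lemma scalar_op_sumr p (I : Type) (r : seq I) (F : I -> R -> R) :
  (forall i, scalar_smooth (F i)) ->
  scalar_op p (\sum_(i <- r) F i) = \sum_(i <- r) scalar_op p (F i).
Proof.
move=> sF; elim: r => [|i r IHr]; first by rewrite !big_nil scalar_op0r.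
by rewrite !big_cons scalar_opDr ?IHr //; exact: scalar_smooth_sum.
Qed.

(** Bootstrapping: if x and y are differentiable k times, the equations show
    that their derivatives are too. *)
Lemma smooth_damped_rotation_ode (a b : R) g : scalar_smooth g ->
  exists x y : R -> R,
    [/\ scalar_smooth x, scalar_smooth y,
        derive1 x = a *: x - b *: y & derive1 y = b *: x + a *: y + g].
Proof.
move=> sg; have [x [y xy]] := damped_rotation_ode a b (scalar_smooth_continuous sg).
have dx (t : R) : derivable x t 1 by have [[]] := xy t.
have dy (t : R) : derivable y t 1 by have [_ []] := xy t.
have x'E : derive1 x = a *: x - b *: y.
  by apply/funext => t; rewrite derive1E; have [[_ ->]] := xy t.
have y'E : derive1 y = b *: x + a *: y + g.
  by apply/funext => t; rewrite derive1E; have [_ [_ ->]] := xy t.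
suff xyk k : differentiable_upto k x /\ differentiable_upto k y.
  by exists x, y; split => //; apply/scalar_smoothP => k; have [] := xyk k.
elim: k => [|k [IHx IHy]] //=; split; split => //.
  rewrite x'E -scaleNr addrC -[a *: x]addr0; apply: differentiable_upto_linear => //.
  apply: differentiable_upto_linear => //.
  by move/scalar_smoothP: (@scalar_smooth0 R).
rewrite y'E -addrA; do 2! [apply: differentiable_upto_linear => //].
by move/scalar_smoothP: sg.
Qed.

Lemma scalar_op_Xsub (a : R) f : scalar_op ('X - a%:P) f = derive1 f - a *: f.
Proof.
rewrite -polyCN scalar_opD -[X in scalar_op X]mul1r scalar_opMX.
by rewrite scalar_op1 scalar_opC scaleNr.
Qed.

Lemma scalar_op_Xsub_surj (a : R) g : scalar_smooth g ->
  exists2 f, scalar_smooth f & scalar_op ('X - a%:P) f = g.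
Proof.
move=> sg; have [x [y [_ sy _ y'E]]] := smooth_damped_rotation_ode a 0 sg.
exists y => //.
by rewrite scalar_op_Xsub y'E scale0r add0r addrAC subrr add0r.
Qed.

(** With x and y from the planar system, (d/dt - a) x = - b y and
    (d/dt - a) y = b x + g', hence ((d/dt - a)^2 + b^2) x = - b g'. The right
    member is g for g' = - g / b. *)
Lemma scalar_op_quad_surj (a b : R) g : b != 0 -> scalar_smooth g ->
  exists2 f, scalar_smooth f & scalar_op (('X - a%:P) ^+ 2 + (b ^+ 2)%:P) f = g.
Proof.
move=> b0 sg; have sg' := scalar_smoothZ (c := - b^-1) sg.
have [x [y [sx sy x'E y'E]]] := smooth_damped_rotation_ode a b sg'.
exists x => //.
rewrite scalar_opD expr2 scalar_op_mul // scalar_opC.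
have -> : scalar_op ('X - a%:P) x = - b *: y.
  by rewrite scalar_op_Xsub x'E addrAC subrr add0r scaleNr.
rewrite -[- b *: y]addr0 scalar_op_linear //; last exact: scalar_smooth0.
rewrite scalar_op0r addr0 scalar_op_Xsub y'E addrAC addrK.
by apply/funext => t; rewrite !fctE /GRing.scale /=; field.
Qed.

(** A complex root a + ib of p is also a root of d, and either b = 0, or the
    remainder of p modulo d is a real polynomial of degree at most one with a
    nonreal root, hence zero. *)
Lemma real_poly_factor p : (1 < size p)%N ->
  exists q d, p = q * d /\
   ((exists a, d = 'X - a%:P) \/
    (exists a b, b != 0 /\ d = ('X - a%:P) ^+ 2 + (b ^+ 2)%:P)).
Proof.
move=> p1; pose pc := map_poly (real_complex R) p.
have /closed_rootP[[a b] rab] : size pc != 1%N.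
  by rewrite size_map_poly neq_ltn p1 orbT.
have [b0|b0] := eqVneq b 0.
  move: rab; rewrite b0 complexr0 fmorph_root => /factor_theorem[q ->].
  by exists q, ('X - a%:P); split => //; left; exists a.
pose d := ('X - a%:P) ^+ 2 + (b ^+ 2)%:P.
have szX : size (('X - a%:P) ^+ 2) = 3%N by rewrite size_exp_XsubC.
have szd : size d = 3%N.
  by rewrite size_polyDl szX // ltnS (leq_trans (size_polyC_leq1 _)).
exists (p %/ d), d; split; last by right; exists a, b.
rewrite {1}(divp_eq p d).
suff -> : p %% d = 0 by rewrite addr0.
set r := p %% d.
have szr : (size r <= 2)%N by rewrite -ltnS -szd ltn_modp -size_poly_eq0 szd.
have rE : r = r`_1 *: 'X + (r`_0)%:P.
  apply/polyP => i; rewrite coefD coefZ coefX coefC.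
  case: i => [|[|i]] /=; rewrite ?(mulr0, mulr1, addr0, add0r) //.
  by rewrite nth_default // (leq_trans szr).
have : root (map_poly (real_complex R) r) (a +i* b)%C.
  have := rab; rewrite /pc {1}(divp_eq p d) rmorphD rmorphM /root hornerD hornerM.
  have -> : (map_poly (real_complex R) d).[(a +i* b)%C] = 0.
    rewrite /d rmorphD rmorphXn /= rmorphB /= map_polyX !map_polyC /=.
    rewrite hornerD horner_exp !hornerE.
    by apply/eqP; rewrite eq_complex /=; apply/andP; split; apply/eqP; ring.
  by rewrite mulr0 add0r.
rewrite rE rmorphD /= map_polyZ map_polyX map_polyC /root !hornerE /=.
rewrite eq_complex /= => /andP[/eqP h1 /eqP h2].
have r1 : r`_1 = 0.
  by move: h2; rewrite mul0r !addr0 => /eqP; rewrite mulf_eq0 (negbTE b0) orbF => /eqP.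
have r0 : r`_0 = 0 by move: h1; rewrite r1 !mul0r subrr add0r.
by rewrite r1 r0 scale0r add0r.
Qed.

Lemma scalar_op_surj p g : p != 0 -> scalar_smooth g ->
  exists2 f, scalar_smooth f & scalar_op p f = g.
Proof.
have [n] := ubnP (size p); elim: n p g => // n IHn p g szp p0 sg.
have [p1|p1] := leqP (size p) 1.
  have pE := size1_polyC p1; have c0 : p`_0 != 0 by rewrite -polyC_eq0 -pE.
  exists ((p`_0)^-1 *: g); first exact: scalar_smoothZ.
  by rewrite pE scalar_opC scalerA coefC eqxx divff // scale1r.
have [q [d [pE dE]]] := real_poly_factor p1.
have d_surj h : scalar_smooth h -> exists2 f, scalar_smooth f & scalar_op d f = h.
  by case: dE => [[a ->]|[a [b [b0 ->]]]];
    [exact: scalar_op_Xsub_surj|exact: scalar_op_quad_surj].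
have q0 : q != 0 by apply: contraNneq p0 => q0; rewrite pE q0 mul0r.
have szq : (size q < n)%N.
  have d1 : (1 < size d)%N.
    case: dE => [[a ->]|[a [b [_ ->]]]]; first by rewrite size_XsubC.
    by rewrite size_polyDl size_exp_XsubC // ltnS (leq_trans (size_polyC_leq1 _)).
  have dn0 : d != 0 by rewrite -size_poly_gt0 (ltn_trans _ d1).
  move: szp d1; rewrite pE size_mul //; move: (size q) (size d) => k l; lia.
have [h sh qh] := IHn q g szq q0 sg.
have [f sf df] := d_surj h sh.
by exists f => //; rewrite pE scalar_op_mul // df.
Qed.

End ScalarOp.

(** * Matrix differential operators *)

Section Trajectories.
Context (R : realType).

Definition component (n : nat) (w : R -> 'cV[R]_n) (j : 'I_n) : R -> R :=
  fun t => w t j 0.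

Lemma component_inj n (w w' : R -> 'cV[R]_n) :
  (forall j, component w j = component w' j) -> w = w'.
Proof.
move=> ww'; apply/funext => t; apply/matrixP => j i; rewrite ord1.
exact: (congr1 (fun f => f t) (ww' j)).
Qed.

Lemma derivable_componentP n (w : R -> 'cV[R]_n) (t : R) :
  derivable w t 1 <-> forall j, derivable (component w j) t 1.
Proof.
rewrite derivable_mxP; split=> [dw j|dw i j]; first exact: dw.
by rewrite ord1; exact: dw.
Qed.

Lemma component_derive1 n (w : R -> 'cV[R]_n) j :
  (forall t : R, derivable w t 1) -> component (derive1 w) j = derive1 (component w j).
Proof.
by move=> dw; apply/funext => t; rewrite /component !derive1E derive_mx // mxE.
Qed.

Lemma component_derive1n n (w : R -> 'cV[R]_n) d j :
  smooth w -> component (derive1n d w) j = derive1n d (component w j).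
Proof.
by move=> sw; elim: d => // d IHd; rewrite !derive1nS component_derive1 ?IHd.
Qed.

Lemma smooth_componentP n (w : R -> 'cV[R]_n) :
  smooth w <-> forall j, scalar_smooth (component w j).
Proof.
split=> [sw j d t|sw].
  by rewrite -component_derive1n //; exact: (derivable_componentP _ _).1 (sw d t) j.
have dw d : (forall j, component (derive1n d w) j = derive1n d (component w j)) ->
    forall t : R, derivable (derive1n d w) t 1.
  by move=> wd t; apply/derivable_componentP => j; rewrite wd; exact: sw.
move=> d; apply: (dw d); elim: d => // d IHd j.
by rewrite !derive1nS component_derive1 ?IHd //; exact: dw.
Qed.

Lemma smooth_component n (w : R -> 'cV[R]_n) j : smooth w -> scalar_smooth (component w j).
Proof. by move/smooth_componentP. Qed.

Lemma component_diffop k n (M : 'M[{poly R}]_(k, n)) (w : R -> 'cV[R]_n) i :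
  smooth w -> component (diffop M w) i = \sum_j scalar_op (M i j) (component w j).
Proof.
move=> sw; apply/funext => t; rewrite /component mxE fct_sumE.
apply: eq_bigr => j _; rewrite /scalar_op fct_sumE; apply: eq_bigr => d _.
by rewrite fctE -component_derive1n.
Qed.

Lemma componentD n (w w' : R -> 'cV[R]_n) j :
  component (w + w') j = component w j + component w' j.
Proof. by apply/funext => t; rewrite /component !fctE mxE. Qed.

Lemma componentB n (w w' : R -> 'cV[R]_n) j :
  component (w - w') j = component w j - component w' j.
Proof. by apply/funext => t; rewrite /component !fctE !mxE. Qed.

Lemma component0 n j : component (0 : R -> 'cV[R]_n) j = 0.
Proof. by apply/funext => t; rewrite /component mxE. Qed.

Lemma smoothD n (w w' : R -> 'cV[R]_n) : smooth w -> smooth w' -> smooth (w + w').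
Proof.
move=> /smooth_componentP sw /smooth_componentP sw'; apply/smooth_componentP => j.
by rewrite componentD; exact: scalar_smoothD.
Qed.

Lemma smoothB n (w w' : R -> 'cV[R]_n) : smooth w -> smooth w' -> smooth (w - w').
Proof.
move=> /smooth_componentP sw /smooth_componentP sw'; apply/smooth_componentP => j.
by rewrite componentB -scaleN1r addrC; exact: scalar_smooth_linear.
Qed.

Lemma smooth0 n : smooth (0 : R -> 'cV[R]_n).
Proof. by apply/smooth_componentP => j; rewrite component0; exact: scalar_smooth0. Qed.

Lemma smooth_diffop k n (M : 'M[{poly R}]_(k, n)) w :
  smooth w -> smooth (diffop M w).
Proof.
move=> sw; apply/smooth_componentP => i; rewrite component_diffop //.
by apply: scalar_smooth_sum => j; apply: scalar_smooth_op; exact: smooth_component.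
Qed.

Lemma diffopD k n (M : 'M[{poly R}]_(k, n)) w w' : smooth w -> smooth w' ->
  diffop M (w + w') = diffop M w + diffop M w'.
Proof.
move=> sw sw'.
have sww := smoothD sw sw'.
apply: component_inj => i.
rewrite componentD.
rewrite (component_diffop M i sww).
rewrite (component_diffop M i sw).
rewrite (component_diffop M i sw').
rewrite -big_split.
apply: eq_bigr => j _.
rewrite componentD.
apply: scalar_opDr; exact: smooth_component.
Qed.

Lemma diffopB k n (M : 'M[{poly R}]_(k, n)) w w' : smooth w -> smooth w' ->
  diffop M (w - w') = diffop M w - diffop M w'.
Proof.
move=> sw sw'.
have := diffopD M (smoothB sw sw') sw'.
by rewrite subrK => ->; rewrite addrK.
Qed.

Lemma diffop0 k n (M : 'M[{poly R}]_(k, n)) : diffop M 0 = 0.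
Proof.
have s0 := @smooth0 n; have := diffopB M s0 s0.
by rewrite subrr => ->; rewrite subrr.
Qed.

Lemma diffop_mul k n q (A : 'M[{poly R}]_(k, n)) (B : 'M[{poly R}]_(n, q)) w :
  smooth w -> diffop (A *m B) w = diffop A (diffop B w).
Proof.
move=> sw; have swj j : scalar_smooth (component w j) by exact: smooth_component.
apply: component_inj => i; rewrite !component_diffop //; last exact: smooth_diffop.
under eq_bigr do rewrite mxE scalar_op_sum.
rewrite exchange_big; apply: eq_bigr => j _; rewrite component_diffop //.
rewrite scalar_op_sumr => [|l]; last exact: scalar_smooth_op.
by apply: eq_bigr => l _; rewrite scalar_op_mul.
Qed.

Lemma diffop_scalar n (p : {poly R}) (w : R -> 'cV[R]_n) i : smooth w ->
  component (diffop p%:M w) i = scalar_op p (component w i).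
Proof.
move=> sw; rewrite component_diffop // (bigD1 i) //= mxE eqxx mulr1n big1 ?addr0 //.
by move=> j ji; rewrite mxE eq_sym (negbTE ji) scalar_op0.
Qed.

Lemma diffop1 n (w : R -> 'cV[R]_n) : smooth w -> diffop 1%:M w = w.
Proof. by move=> sw; apply: component_inj => i; rewrite diffop_scalar // scalar_op1. Qed.

Lemma diffop_col_mx k1 k2 n (A : 'M[{poly R}]_(k1, n)) (B : 'M[{poly R}]_(k2, n)) w :
  diffop (col_mx A B) w = fun t => col_mx (diffop A w t) (diffop B w t).
Proof.
apply/funext => t; apply/colP => i.
by case: (split_ordP i) => j ->; rewrite ?col_mxEu ?col_mxEd !mxE;
  apply: eq_bigr => l _; rewrite ?col_mxEu ?col_mxEd.
Qed.

(** The latent variable l in the equations M(d/dt) l = w can be eliminated. *)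
Definition has_kernel_representation k n (M : 'M[{poly R}]_(k, n)) : Prop :=
  exists q (K : 'M[{poly R}]_(q, k)), forall w : R -> 'cV[R]_k, smooth w ->
    ((exists2 l, smooth l & diffop M l = w) <-> diffop K w = 0).

(** A left inverse of U suffices: it makes M l = w and U M l = U w
    equivalent. *)
Lemma kernel_representation_row_equiv k n (M : 'M[{poly R}]_(k, n)) (U V : 'M_k) :
  V *m U = 1%:M -> has_kernel_representation (U *m M) -> has_kernel_representation M.
Proof.
move=> VU [q [K KP]]; exists q, (K *m U) => w sw.
rewrite (diffop_mul K U sw) -(KP _ (smooth_diffop (M := U) sw)).
split=> [] [l sl]; rewrite ?(diffop_mul U M sl) => Ml.
  by exists l => //; rewrite (diffop_mul U M sl) Ml.
exists l => //; have sMl := smooth_diffop (M := M) sl.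
rewrite -(diffop1 sMl) -(diffop1 sw) -VU (diffop_mul V U sMl) (diffop_mul V U sw).
by rewrite Ml.
Qed.

(** Separates the latent variable of the first column from the others. *)
Definition traj_cons n (f : R -> R) (w : R -> 'cV[R]_n) : R -> 'cV[R]_n.+1 :=
  fun t => \col_i (if unlift ord0 i is Some j then w t j 0 else f t).

Lemma component_cons0 n f (w : R -> 'cV[R]_n) : component (traj_cons f w) ord0 = f.
Proof. by apply/funext => t; rewrite /component mxE unlift_none. Qed.

Lemma component_cons_lift n f (w : R -> 'cV[R]_n) j :
  component (traj_cons f w) (lift ord0 j) = component w j.
Proof. by apply/funext => t; rewrite /component mxE liftK. Qed.

Lemma smooth_cons n f (w : R -> 'cV[R]_n) :
  scalar_smooth f -> smooth w -> smooth (traj_cons f w).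
Proof.
move=> sf /smooth_componentP sw; apply/smooth_componentP => i.
by case: (unliftP ord0 i) => [j ->|->];
  [rewrite component_cons_lift; exact: sw|rewrite component_cons0].
Qed.

Lemma traj_consE n (l : R -> 'cV[R]_n.+1) : smooth l ->
  exists f w, [/\ scalar_smooth f, smooth w & l = traj_cons f w].
Proof.
move=> sl; exists (component l ord0), (fun t => row' ord0 (l t)); split.
- exact: smooth_component.
- apply/smooth_componentP => j.
  have -> : component (fun t => row' ord0 (l t)) j = component l (lift ord0 j).
    by apply/funext => t; rewrite /component mxE.
  exact: smooth_component.
- apply: component_inj => i; case: (unliftP ord0 i) => [j ->|->];
    rewrite ?component_cons0 ?component_cons_lift //.
  by apply/funext => t; rewrite /component mxE.
Qed.

Lemma diffop_cons k n (M : 'M[{poly R}]_(k, n.+1)) f w i :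
  scalar_smooth f -> smooth w ->
  component (diffop M (traj_cons f w)) i =
    scalar_op (M i ord0) f + component (diffop (col' ord0 M) w) i.
Proof.
move=> sf sw; rewrite !component_diffop //; last exact: smooth_cons.
rewrite big_ord_recl component_cons0; congr (_ + _); apply: eq_bigr => j _.
by rewrite component_cons_lift mxE.
Qed.

Lemma kernel_representation_col0 k n (M : 'M[{poly R}]_(k, n.+1)) :
  (forall i, M i ord0 = 0) ->
  has_kernel_representation (col' ord0 M) -> has_kernel_representation M.
Proof.
move=> M0 [q [K KP]]; exists q, K => w sw; rewrite -KP //.
have consE f l : scalar_smooth f -> smooth l ->
    diffop M (traj_cons f l) = diffop (col' ord0 M) l.
  by move=> sf sl; apply: component_inj => i; rewrite diffop_cons // M0 scalar_op0 add0r.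
split=> [] [l sl] <-.
  by have [f [l' [sf sl' ->]]] := traj_consE sl; exists l'; rewrite ?consE.
have s0 := @scalar_smooth0 R.
by exists (traj_cons 0 l); [exact: smooth_cons|rewrite consE].
Qed.

(** The pivot's equation is erased by a matrix that clears its row and keeps the
    others in place, so that the number of rows does not change. *)
Lemma component_erase_row k (i0 i : 'I_k) (w : R -> 'cV[R]_k) : smooth w ->
  component (diffop (1%:M - delta_mx i0 i0) w) i = if i == i0 then 0 else component w i.
Proof.
move=> sw; rewrite component_diffop // (bigD1 i) //= big1 => [|j ji].
  rewrite !mxE eqxx addr0; case: eqP => _; first by rewrite subrr scalar_op0.
  by rewrite subr0 scalar_op1.
rewrite !mxE eq_sym (negbTE ji); case: eqP => [ii0|]; last by rewrite subr0 scalar_op0.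
by rewrite -ii0 (negbTE ji) subr0 scalar_op0.
Qed.

(** Given the other latent variables, the equation of row i0 has a solution in
    the first one by [scalar_op_surj]; the other equations do not contain it. *)
Lemma kernel_representation_pivot k n (M : 'M[{poly R}]_(k, n.+1)) (i0 : 'I_k) :
  M i0 ord0 != 0 -> (forall i, i != i0 -> M i ord0 = 0) ->
  has_kernel_representation ((1%:M - delta_mx i0 i0) *m col' ord0 M) ->
  has_kernel_representation M.
Proof.
set D := _ - _ => Mi0 M0 [q [K KP]]; exists q, (K *m D) => w sw.
rewrite diffop_mul // -KP; last exact: smooth_diffop.
split=> [] [l sl].
  have [f [l' [sf sl' lE]]] := traj_consE sl; move=> Ml.
  exists l'; first exact: sl'.
  rewrite (diffop_mul D _ sl'); apply: component_inj => i.
  rewrite (component_erase_row _ _ sw) (component_erase_row _ _ (smooth_diffop sl')) -Ml lE.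
  by case: ifPn => // ii0; rewrite diffop_cons // M0 // scalar_op0 add0r.
rewrite diffop_mul // => Dlw.
have [|f sf fE] := @scalar_op_surj R _ (component (w - diffop (col' ord0 M) l) i0) Mi0.
  by apply/smooth_component/(smoothB sw)/smooth_diffop/sl.
exists (traj_cons f l); first exact: smooth_cons.
apply: component_inj => i; rewrite diffop_cons //.
have [->|ii0] := eqVneq i i0; first by rewrite fE componentB subrK.
have /(congr1 (fun w => component w i)) := Dlw.
rewrite (component_erase_row _ _ sw) (component_erase_row _ _ (smooth_diffop sl)).
by rewrite (negbTE ii0) M0 // scalar_op0 add0r.
Qed.

(** For a fixed first column the induction is on the sum of the sizes of its
    entries: replacing an entry by its remainder modulo another nonzero one that
    is not larger makes this sum smaller. When no two entries are nonzero, the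
    column is zero or has a single pivot. *)
Lemma image_has_kernel_representation k n (M : 'M[{poly R}]_(k, n)) :
  has_kernel_representation M.
Proof.
elim: n k M => [|n IHn] k M.
  exists k, 1%:M => w sw; rewrite diffop1 //.
  have M0 l : smooth l -> diffop M l = 0.
    by move=> sl; apply: component_inj => i; rewrite component_diffop // big_ord0 component0.
  split=> [[l sl <-]|->]; first exact: M0.
  by exists 0; [exact: smooth0|exact/M0/smooth0].
have [N] := ubnP (\sum_i size (M i ord0)).
elim: N M => // N IHN M leN.
have [/existsP[i /existsP[j /and4P[ij Mi Mj szij]]]|noij] :=
  boolP [exists i, exists j, [&& i != j, M i ord0 != 0, M j ord0 != 0 &
     (size (M j ord0) <= size (M i ord0))%N]].
  (* U subtracts c times row j from row i. *)
  pose c := M i ord0 %/ M j ord0.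
  pose U : 'M_k := 1%:M - c *: delta_mx i j; pose V : 'M_k := 1%:M + c *: delta_mx i j.
  have VU : V *m U = 1%:M.
    rewrite mulmxDl mulmxBr !mul1mx mulmxBr mulmx1 -scalemxAl -scalemxAr.
    by rewrite mul_delta_mx_0 1?eq_sym // !scaler0 subr0 subrK.
  apply: (kernel_representation_row_equiv VU); apply: IHN.
  have UM a : (U *m M) a ord0 = if a == i then M i ord0 %% M j ord0 else M a ord0.
    rewrite mulmxBl mul1mx -scalemxAl !mxE (bigD1 j) //= big1 => [|b bj].
      rewrite mxE eqxx andbT addr0; case: eqP => [->|_]; last by rewrite mul0r mulr0 subr0.
      by rewrite mul1r {1}(divp_eq (M i ord0) (M j ord0)) addrAC subrr add0r.
    by rewrite mxE (negbTE bj) andbF mul0r.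
  rewrite -ltnS; apply: leq_trans leN; rewrite ltnS.
  rewrite (bigD1 i) //= [X in (_ < X)%N](bigD1 i) //= UM eqxx.
  under eq_bigr => a ai do rewrite UM (negbTE ai).
  by rewrite ltn_add2r (leq_trans _ szij) // ltn_modp.
have [/existsP[i0 Mi0]|M0] := boolP [exists i, M i ord0 != 0]; last first.
  apply: kernel_representation_col0 => // i.
  by apply/eqP; apply: contraNT M0 => Mi; apply/existsP; exists i.
apply: (kernel_representation_pivot Mi0) => // i ii0; apply/eqP.
apply: contraNT noij => Mi; case: (leqP (size (M i ord0)) (size (M i0 ord0))) => sz.
  by apply/existsP; exists i0; apply/existsP; exists i; rewrite eq_sym ii0 Mi Mi0.
by apply/existsP; exists i; apply/existsP; exists i0; rewrite ii0 Mi Mi0 ltnW.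
Qed.

(** Since P adj(P) = det P, a solution is adj(P)(d/dt) z, where z solves
    (det P)(d/dt) z = v componentwise. *)
Lemma diffop_surj p (P : 'M[{poly R}]_p) v : \det P != 0 -> smooth v ->
  exists2 y, smooth y & diffop P y = v.
Proof.
move=> P0 sv.
have /choice[z zP] i : exists f, scalar_smooth f /\ scalar_op (\det P) f = component v i.
  by have [|f sf fE] := @scalar_op_surj R _ (component v i) P0;
    [exact: smooth_component|exists f].
pose Z t : 'cV[R]_p := \col_i z i t.
have cZ i : component Z i = z i by apply/funext => t; rewrite /component mxE.
have sZ : smooth Z by apply/smooth_componentP => i; rewrite cZ; have [] := zP i.
exists (diffop (\adj P) Z); first exact: smooth_diffop.
rewrite -diffop_mul // mul_mx_adj; apply: component_inj => i.
by rewrite diffop_scalar // cZ; have [] := zP i.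
Qed.

End Trajectories.

(** * Behaviours and contracts *)

Section Contracts.
Context (R : realType) (m p : nat).
Implicit Types (A E : input_system R m) (F G : system R m p).

Lemma input_behaviourD A u v :
  input_behaviour A u -> input_behaviour A v -> input_behaviour A (u + v).
Proof.
move=> [su Au] [sv Av]; split; first exact: smoothD.
by rewrite diffopD // Au Av; exact: addr0.
Qed.

Lemma behaviourD F u y u' y' :
  behaviour F (u, y) -> behaviour F (u', y') -> behaviour F (u + u', y + y').
Proof.
move=> [/= su sy uy] [/= su' sy' uy']; split => /=; try exact: smoothD.
by rewrite !diffopD // uy uy'.
Qed.

Lemma join_behaviourP A1 A2 u :
  join_behaviour A1 A2 u <-> exists l1 l2,
    [/\ input_behaviour A1 l1, input_behaviour A2 l2 & u = l1 + l2].
Proof.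
split=> [[su [l1 [l2 [s1 s2 <- A1l A2l]]]]|[l1 [l2 [[s1 A1l] [s2 A2l] ->]]]].
  by exists l1, l2.
by split; [exact: smoothD|exists l1, l2].
Qed.

Lemma input_behaviour0 A : input_behaviour A 0.
Proof. by split; [exact: smooth0|exact: diffop0]. Qed.

Lemma join_behaviourl A1 A2 : input_behaviour A1 `<=` join_behaviour A1 A2.
Proof.
move=> u A1u; apply/join_behaviourP; exists u, 0.
by split; rewrite ?addr0 //; exact: input_behaviour0.
Qed.

Lemma join_behaviourr A1 A2 : input_behaviour A2 `<=` join_behaviour A1 A2.
Proof.
move=> u A2u; apply/join_behaviourP; exists 0, u.
by split; rewrite ?add0r //; exact: input_behaviour0.
Qed.

Lemma join_behaviour_min A1 A2 A :
  input_behaviour A1 `<=` input_behaviour A ->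
  input_behaviour A2 `<=` input_behaviour A ->
  join_behaviour A1 A2 `<=` input_behaviour A.
Proof.
move=> A1A A2A u /join_behaviourP[l1 [l2 [/A1A Al1 /A2A Al2 ->]]].
exact: input_behaviourD.
Qed.

Lemma col_mx_fun_inj k1 k2 (f1 g1 : R -> 'cV[R]_k1) (f2 g2 : R -> 'cV[R]_k2) :
  (fun t => col_mx (f1 t) (f2 t)) = (fun t => col_mx (g1 t) (g2 t)) ->
  f1 = g1 /\ f2 = g2.
Proof.
move=> fg; split; apply/funext => t;
  by have /(congr1 (@^~ t))/eq_col_mx[] := fg.
Qed.

(** With l = l1 and l2 = u - l, the join asks for l such that A1 l = 0 and
    A2 l = A2 u, that is, for (0, A2 u) to be in the image of the stacked matrix
    (A1, A2). *)
Lemma join_exists A1 A2 : exists A, is_join A1 A2 A.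
Proof.
have [q [K KP]] := image_has_kernel_representation (col_mx (input_mx A1) (input_mx A2)).
pose N : 'M[{poly R}]_(input_rows A1 + input_rows A2, m) := col_mx 0 (input_mx A2).
have NE u : smooth u -> diffop N u = fun t => col_mx 0 (diffop (input_mx A2) u t).
  move=> su; rewrite diffop_col_mx; apply/funext => t; congr (col_mx _ _).
  have -> : diffop (0 : 'M[{poly R}]_(input_rows A1, m)) u = 0; last by [].
  apply: component_inj => i; rewrite component_diffop // component0 big1 // => j _.
  by rewrite mxE scalar_op0.
exists (InputSystem (K *m N)); apply/seteqP; split=> u /=.
  move=> [su /=]; rewrite diffop_mul // => KNu.
  have [l sl] := (KP _ (smooth_diffop su)).2 KNu.
  rewrite diffop_col_mx NE // => /col_mx_fun_inj[A1l A2l].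
  apply/join_behaviourP; exists l, (u - l); split; first by [].
    by split; [exact: smoothB|rewrite diffopB // A2l; exact: subrr].
  by rewrite addrC subrK.
move=> /join_behaviourP[l1 [l2 [[s1 A1l] [s2 A2l] uE]]].
have su : smooth u by rewrite uE; exact: smoothD.
split=> //=; rewrite diffop_mul //; apply/KP; first exact: smooth_diffop.
exists l1 => //; rewrite diffop_col_mx NE // A1l uE diffopD // A2l.
by apply/funext => t; rewrite fctE addr0.
Qed.

Lemma behaviour_meet G1 G2 : behaviour (meet G1 G2) = behaviour G1 `&` behaviour G2.
Proof.
apply/seteqP; split=> -[u y].
  by move=> [/= su sy]; rewrite !diffop_col_mx => /col_mx_fun_inj[].
move=> [[/= su sy e1] [_ _ /= e2]]; split=> //=.
by rewrite !diffop_col_mx e1 e2.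
Qed.

(** Inputs of a system in input-output form are free. *)
Lemma io_system_total (S : io_system R m p) u : smooth u ->
  exists2 y, smooth y & behaviour S (u, y).
Proof.
move=> su; have [detP _] := io_formP S.
have P0 : \det (io_out_mx S) != 0.
  by move: detP; rewrite unitmxE det_map_mx unitfE tofrac_eq0.
have [y sy yE] := diffop_surj P0 (smooth_diffop (M := io_in_mx S) su).
by exists y.
Qed.

(** Among the environments compatible with the contract, the assumptions are
    the largest one. *)
Lemma implements_behaviour (S : io_system R m p) A G :
  implements S (Contract A G) <->
  interconnection (input_behaviour A) S `<=` behaviour G.
Proof.
split=> [|SG E EA w [Sw /EA Aw]]; first by apply.
exact: SG.
Qed.

End Contracts.

Theorem theorem6 (R : realType) (m p : nat)
    (A1 A2 : input_system R m) (G1 G2 : system R m p)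
    (hyp : input_behaviour A1 = input_behaviour A2 \/
           interconnection (join_behaviour A1 A2) G1 =
           interconnection (join_behaviour A1 A2) G2) :
  (exists A : input_system R m, is_join A1 A2 A) /\
  (forall A : input_system R m, is_join A1 A2 A ->
     is_conjunction (Contract A1 G1) (Contract A2 G2)
       (Contract A (meet G1 G2))).
Proof.
split; first exact: join_exists.
move=> A AE.
have le1 : input_behaviour A1 `<=` input_behaviour A by rewrite AE; exact: join_behaviourl.
have le2 : input_behaviour A2 `<=` input_behaviour A by rewrite AE; exact: join_behaviourr.
have refines_meet A' G' : input_behaviour A' `<=` input_behaviour A ->
    behaviour (meet G1 G2) `<=` behaviour G' ->
    refines (Contract A (meet G1 G2)) (Contract A' G').
  move=> le leG; split=> [E /subset_trans|S /implements_behaviour SG]; first exact.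
  by apply/implements_behaviour => w [Sw /le Aw]; apply/leG/SG.
split.
- by apply: refines_meet => //; rewrite behaviour_meet => w [].
- by apply: refines_meet => //; rewrite behaviour_meet => w [].
move=> [A' G'] [env1 impl1] [env2 impl2]; split=> [E EA|S SC'].
  apply: subset_trans EA _; rewrite /= AE.
  by apply: join_behaviour_min; [exact: env1|exact: env2].
have /implements_behaviour S1 := impl1 S SC'.
have /implements_behaviour S2 := impl2 S SC'.
apply/implements_behaviour; rewrite behaviour_meet => -[u y] [Suy /=].
case: hyp => [A12|G12].
  have AA1 : input_behaviour A `<=` input_behaviour A1.
    by rewrite AE; apply: join_behaviour_min; rewrite -?A12.
  by move=> /AA1 Au; split; [apply: S1|apply: S2]; split; rewrite -?A12.
rewrite AE => /join_behaviourP[l1 [l2 [A1l A2l uE]]].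
have [y1 sy1 Sy1] := io_system_total S A1l.1.
have [_ sy _] := Suy.
have Sy2 : behaviour S (l2, y - y1).
  have [/= _ _ eu] := Suy; have [/= _ _ e1] := Sy1.
  split=> /=; [exact: A2l.1|exact: smoothB|].
  rewrite diffopB // eu e1 uE diffopD; [|exact: A1l.1|exact: A2l.1].
  by rewrite addrAC subrr add0r.
(* The second hypothesis: inside the join the two guarantees agree. *)
have both l z : join_behaviour A1 A2 l -> behaviour G1 (l, z) \/ behaviour G2 (l, z) ->
    (behaviour G1 `&` behaviour G2) (l, z).
  move=> jl [G1z|G2z].
    have [G2z _] : interconnection (join_behaviour A1 A2) G2 (l, z) by rewrite -G12.
    by [].
  have [G1z _] : interconnection (join_behaviour A1 A2) G1 (l, z) by rewrite G12.
  by [].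
have [G1y1 G2y1] : (behaviour G1 `&` behaviour G2) (l1, y1).
  by apply: both; [exact: join_behaviourl|left; exact: S1].
have [G1y2 G2y2] : (behaviour G1 `&` behaviour G2) (l2, y - y1).
  by apply: both; [exact: join_behaviourr|right; exact: S2].
have -> : (u, y) = (l1 + l2, y1 + (y - y1)) by rewrite -uE [y1 + _]addrC subrK.
by split; exact: behaviourD.
Qed.
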